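(* Let $\mathcal G$ be a locally finite, connected metric graph with finite volume $|\mathcal G|>0$, diameter $\mathrm{Diam}(\mathcal G)>0$, and finite Betti number. Then the second eigenvalue $\mu_2(\mathcal G)$ of the Neumann realisation of the Laplacian on $\mathcal G$ satisfies $$\mu_2(\mathcal G)\ge\frac{2}{|\mathcal G|\,\mathrm{Diam}(\mathcal G)}.$$
   Context: A metric graph $\mathcal G$ is given by finite or countably infinite sets $V$ of vertices and $E$ of edges, each edge $e$ having a length $\ell_e\in(0,\infty)$; it is obtained from the disjoint union of intervals $[0,\ell_e]$ by gluing endpoints at the vertices (loops and parallel edges allowed). It carries the shortest-path metric $\mathrm{dist}_{\mathcal G}$ and the sum of the Lebesgue measures on the edges; its volume is $|\mathcal G|=\sum_e\ell_e$, its diameter is $\mathrm{Diam}(\mathcal G)=\sup_{x,y\in\mathcal G}\mathrm{dist}_{\mathcal G}(x,y)$. It is locally finite if every vertex has finite degree. The (first) Betti number is the number of independent cycles of $\mathcal G$; it is finite if and only if some compact subgraph contains all cycles of $\mathcal G$. $H^1(\mathcal G)$ is the space of continuous $f$ on $\mathcal G$ with $f_e\in H^1(0,\ell_e)$ for every edge and $\sum_e\|f_e\|^2_{H^1(0,\ell_e)}<\infty$. The Neumann realisation is the self-adjoint operator on $L^2(\mathcal G)$ associated with $f\mapsto\int_{\mathcal G}|f'|^2dx$ on $H^1(\mathcal G)$. For finite volume it has compact resolvent, with eigenvalues $0=\mu_1<\mu_2\le\cdots$ counted with multiplicity. *)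

(* Defs.v *)
From HB Require Import structures.
From mathcomp Require Import all_boot all_order all_algebra.
From mathcomp Require Import all_classical all_reals all_analysis.
Set Implicit Arguments.
Unset Strict Implicit.
Unset Printing Implicit Defensive.
Import Order.TTheory GRing.Theory Num.Theory.
Import numFieldNormedType.Exports.
Local Open Scope classical_set_scope.
Local Open Scope ring_scope.

(* All function spaces are real: the Neumann Laplacian commutes with complex
   conjugation, so its eigenvalues and multiplicities are the complex ones.  *)

(* [countType] means finite or countably infinite.  The orientation given by
   [mg_src]/[mg_tgt] only serves to parametrise the edges; loops and parallel
   edges are allowed.  [mg_base] makes the graph nonempty, which the library
   requires of the carrier of a sigma-algebra; it plays no other role.       *)
Record metric_graph (R : realType) := MetricGraph {
  mg_vertex : countType;
  mg_edge : countType;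
  mg_src : mg_edge -> mg_vertex;
  mg_tgt : mg_edge -> mg_vertex;
  mg_length : mg_edge -> R;
  mg_length_gt0 : forall e, 0 < mg_length e;
  mg_base : mg_vertex }.

Definition edge_interior (R : realType) (G : metric_graph R) (e : mg_edge G) :=
  {t : R | 0 < t < mg_length e}.

(* The disjoint union of the [0, l_e] with endpoints glued at the vertices:
   every class of the quotient is a vertex or a single interior point.       *)
Inductive graph_point (R : realType) (G : metric_graph R) :=
| Vertex of mg_vertex G
| Interior (e : mg_edge G) of edge_interior e.
Arguments Vertex {R G}.
Arguments Interior {R G}.

(* The quotient map on the edge [0, l_e], extended to R by the nearest
   endpoint; the extension affects neither the measurable sets of the graph
   nor its measure.                                                          *)
Definition edge_point (R : realType) (G : metric_graph R) (e : mg_edge G)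
    (t : R) : graph_point G :=
  if insub t is Some u then Interior e u
  else if t <= 0 then Vertex (mg_src e) else Vertex (mg_tgt e).

(* [graph_path p q l]: some path made of finitely many segments of edges, of
   total length [l], joins [p] to [q].                                       *)
Inductive graph_path (R : realType) (G : metric_graph R) :
    graph_point G -> graph_point G -> R -> Prop :=
| graph_path_nil p : graph_path p p 0
| graph_path_cons (e : mg_edge G) (s t : R) q l :
    0 <= s <= mg_length e -> 0 <= t <= mg_length e ->
    graph_path (edge_point e t) q l ->
    graph_path (edge_point e s) q (`|s - t| + l).

Section graph_geometry.
Context (R : realType) (G : metric_graph R).

Definition graph_connected := forall p q : graph_point G, exists l, graph_path p q l.

Definition graph_dist (p q : graph_point G) : \bar R :=
  ereal_inf [set l%:E | l in [set l | graph_path p q l]].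

Definition graph_diameter : \bar R :=
  ereal_sup [set graph_dist pq.1 pq.2 | pq in [set: graph_point G * graph_point G]].

Definition graph_volume : \bar R :=
  \esum_(e in [set: mg_edge G]) (mg_length e)%:E.

Definition locally_finite_graph := forall v : mg_vertex G,
  finite_set [set e : mg_edge G | mg_src e = v \/ mg_tgt e = v].

(* Algebraic cycles: finitely supported 1-chains with zero boundary.  Both
   sums below are finite because the support of [c] is.                      *)
Definition graph_cycle (c : mg_edge G -> R) :=
  finite_set [set e | c e != 0] /\
  forall v : mg_vertex G,
    \sum_(e \in [set e | mg_tgt e = v]) c e =
    \sum_(e \in [set e | mg_src e = v]) c e.

Definition independent_cycles (n : nat) (c : 'I_n -> mg_edge G -> R) :=
  (forall i, graph_cycle (c i)) /\
  forall a : 'I_n -> R,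
    (forall e, \sum_(i < n) a i * c i e = 0) -> forall i, a i = 0.

Definition betti_number : \bar R :=
  ereal_sup [set n%:R%:E | n in
    [set n : nat | exists c : 'I_n -> mg_edge G -> R, independent_cycles c]].

Definition continuous_on_graph (f : graph_point G -> R) :=
  forall p eps, 0 < eps -> exists2 delta, 0 < delta &
    forall q, (graph_dist p q < delta%:E)%E -> `|f p - f q| < eps.

End graph_geometry.

HB.instance Definition _ (R : realType) (G : metric_graph R) :=
  gen_eqMixin (graph_point G).
HB.instance Definition _ (R : realType) (G : metric_graph R) :=
  gen_choiceMixin (graph_point G).
HB.instance Definition _ (R : realType) (G : metric_graph R) :=
  isPointed.Build (graph_point G) (Vertex (mg_base G)).

Section graph_sigma_algebra.
Context (R : realType) (G : metric_graph R).

(* The vertices being countable, these are the Borel sets of the graph.      *)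
Definition graph_measurable : set (set (graph_point G)) :=
  [set A | forall e : mg_edge G,
    measurable (edge_point e @^-1` A : set (measurableTypeR R))].

Let graph_measurable0 : graph_measurable set0.
Proof. by move=> e; rewrite preimage_set0; exact: measurable0. Qed.

Let graph_measurableC A : graph_measurable A -> graph_measurable (~` A).
Proof. by move=> mA e; rewrite preimage_setC; apply: measurableC; exact: mA. Qed.

Let graph_measurable_bigcup (F : (set (graph_point G))^nat) :
  (forall i, graph_measurable (F i)) -> graph_measurable (\bigcup_i F i).
Proof.
by move=> mF e; rewrite preimage_bigcup; apply: bigcupT_measurable => i;
  exact: mF.
Qed.

HB.instance Definition _ := @isMeasurable.Build default_measure_display
  (graph_point G) graph_measurable graph_measurable0 graph_measurableC
  graph_measurable_bigcup.

End graph_sigma_algebra.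

Lemma esum_exchange (R : realType) (S T : choiceType) (a : S -> T -> \bar R) :
  (forall i j, 0 <= a i j)%E ->
  \esum_(i in [set: S]) \esum_(j in [set: T]) a i j =
  \esum_(j in [set: T]) \esum_(i in [set: S]) a i j.
Proof.
move=> a0; rewrite esum_esum//.
rewrite (esum_esum (I := [set: T]) (J := fun=> [set: S]) (a := fun j i => a i j))//.
rewrite (reindex_esum ([set: T] `*`` (fun=> [set: S])) _ (fun x => (x.2, x.1)))//.
split=> //= [[x y] [x' y'] _ _ /= [-> ->]//|[x y] _ /=].
by exists (y, x).
Qed.

Section graph_measure.
Context (R : realType) (G : metric_graph R).
Local Open Scope ereal_scope.

(* The sum of the Lebesgue measures on the edges.                            *)
Definition graph_measure (A : set (graph_point G)) : \bar R :=
  \esum_(e in [set: mg_edge G])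
    @lebesgue_measure R (`]0%R, mg_length e[ `&` edge_point e @^-1` A).

Let graph_measure0 : graph_measure set0 = 0.
Proof.
by rewrite /graph_measure esum1// => e _; rewrite preimage_set0 setI0 measure0.
Qed.

Let graph_measure_ge0 A : 0 <= graph_measure A.
Proof. by apply: esum_ge0 => e _; exact: measure_ge0. Qed.

Let graph_measure_semi_sigma_additive : semi_sigma_additive graph_measure.
Proof.
move=> F mF tF mUF.
have -> : graph_measure (\bigcup_n F n) = \sum_(n <oo) graph_measure (F n).
  rewrite /graph_measure nneseries_esumT; last first.
    by move=> n; exact: graph_measure_ge0.
  rewrite esum_exchange//.
  apply: eq_esum => e _.
  rewrite preimage_bigcup setI_bigcupr measure_bigcup//=.
  - rewrite -nneseries_esumT//; apply: eq_eseriesl => n; exact: in_setT.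
  - by move=> n _; apply: measurableI; [exact: measurable_itv|exact: mF].
  - apply: trivIset_setIl; move/trivIsetP: tF => tF.
    apply/trivIsetP => i j _ _ ij.
    by rewrite -preimage_setI tF// preimage_set0.
by apply: is_cvg_nneseries => n _ _; exact: graph_measure_ge0.
Qed.

HB.instance Definition _ := isMeasure.Build _ (graph_point G) R graph_measure
  graph_measure0 graph_measure_ge0 graph_measure_semi_sigma_additive.

End graph_measure.

(* Weak derivatives on (0, l) are tested against C^1 functions with compact
   support in (0, l).                                                        *)
Definition test_function (R : realType) (l : R) (phi : R -> R) :=
  [/\ forall t, derivable phi t 1, continuous (derive1 phi) &
      exists a b, [/\ 0 < a, b < l & forall t, phi t != 0 -> a <= t <= b]].

Definition square_integrable (R : realType) (l : R) (u : R -> R) :=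
  measurable_fun `]0, l[ u /\
  (\int[@lebesgue_measure R]_(t in `]0%R, l[) (u t ^+ 2)%:E < +oo)%E.

(* [u] belongs to H^1(0, l) and has weak derivative [u'].                    *)
Definition H1_interval (R : realType) (l : R) (u u' : R -> R) :=
  [/\ square_integrable l u, square_integrable l u' &
      forall phi, test_function l phi ->
        \int[@lebesgue_measure R]_(t in `]0, l[) (u t * derive1 phi t) =
        - \int[@lebesgue_measure R]_(t in `]0, l[) (u' t * phi t)].

Section neumann.
Context (R : realType) (G : metric_graph R).

Let mu : {measure set (graph_point G) -> \bar R} := @graph_measure R G.

(* [f] belongs to H^1(G) and has weak derivative [f'] on every edge; [f'] is
   determined almost everywhere.                                             *)
Definition H1_graph (f f' : graph_point G -> R) :=
  [/\ continuous_on_graph f,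
      forall e, H1_interval (mg_length e) (f \o edge_point e) (f' \o edge_point e) &
      (\esum_(e in [set: mg_edge G])
         \int[@lebesgue_measure R]_(t in `]0%R, mg_length e[)
           (f (edge_point e t) ^+ 2 + f' (edge_point e t) ^+ 2)%:E < +oo)%E].

(* The operator of the form int f'v' with domain H^1(G): [f] is in its domain
   and is mapped to [h].                                                     *)
Definition neumann_laplacian (f h : graph_point G -> R) :=
  h \in Lfun mu 2%:E /\
  exists2 f', H1_graph f f' &
    forall v v', H1_graph v v' ->
      \int[mu]_x (f' x * v' x) = \int[mu]_x (h x * v x).

Definition L2_independent (n : nat) (f : 'I_n -> graph_point G -> R) :=
  forall a : 'I_n -> R,
    {ae mu, forall x, \sum_(i < n) a i * f i x = 0} -> forall i, a i = 0.

(* At least [n] eigenvalues, counted with multiplicity, lie in [L].          *)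
Definition has_neumann_eigenvalues (L : set R) (n : nat) :=
  exists (lam : 'I_n -> R) (f : 'I_n -> graph_point G -> R),
    [/\ forall i, L (lam i),
        forall i, neumann_laplacian (f i) (fun x => lam i * f i x) &
        L2_independent f].

(* [m] is the [k]-th term ([k >= 1]) of the nondecreasing list of eigenvalues
   repeated according to multiplicity: at least [k] of them are [<= m] and
   fewer than [k] are [< m].                                                 *)
Definition neumann_eigenvalue (k : nat) (m : R) :=
  has_neumann_eigenvalues [set lam | lam <= m] k /\
  ~ has_neumann_eigenvalues [set lam | lam < m] k.

End neumann.

(* Main.v *)
Require Import Defs.
From HB Require Import structures.
From mathcomp Require Import all_boot all_order all_algebra.
From mathcomp Require Import all_classical all_reals all_analysis.
From mathcomp Require Import measurable_realfun ring lra.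
Import Order.TTheory GRing.Theory Num.Theory.
Import numFieldNormedType.Exports.
Local Open Scope classical_set_scope.
Local Open Scope ring_scope.

(* For a path from x to y one may shortcut until its segments are pairwise
   disjoint, so that the energy picked up along it is at most that of the whole
   graph; hence |f x - f y|^2 <= dist(x, y) * int |f'|^2 <= Diam * int |f'|^2.
   If int f = 0, integrating in x and then in y gives
   2 int f^2 <= |G| Diam int |f'|^2.  Testing the eigenvalue equation against 1
   shows that eigenfunctions of nonzero eigenvalues have mean zero, while those
   of the eigenvalue 0 are constant, so that two independent eigenfunctions
   cannot both have eigenvalue 0. *)

(** * The fundamental theorem of calculus for weak derivatives *)

(** They are recovered by testing against a plateau whose derivative is a difference of two narrow
    bumps: the pairing compares averages of the function near the two endpoints, and continuity
    turns the averages into values. Shortcutting matters because a path may run over the same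
    stretch of an edge several times, and its energy would then be counted with multiplicity.
    Distances are infima of path lengths, not assumed to be attained, so every estimate along a path
    carries a slack. The factor 2 of the bound comes from expanding (f x - f y)^2: the cross term
    has mean zero, and each of the two squares contributes |G| times the squared norm. *)

Lemma is_derive_quadratic_error {R : realType} (f : R -> R) (x d C : R) :
  (forall h, `|f (x + h) - f x - d * h| <= C * h ^+ 2) -> is_derive x 1 f d.
Proof.
move=> fC.
have C0 : 0 <= C.
  by have := fC 1; rewrite expr1n !mulr1 => /(le_trans (normr_ge0 _)).
suff lim_d : h^-1 *: (f (h *: 1 + x) - f x) @[h --> 0^'] --> d.
  by apply: DeriveDef; [apply/cvg_ex; exists d|exact: cvg_lim].
apply/cvgrPdist_le => e e0; near=> h.
have h0 : h != 0 by near: h; exact: nbhs_dnbhs_neq.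
have he : C * `|h| <= e.
  have : `|h| <= e / (C + 1).
    near: h; apply: dnbhs0_le; rewrite divr_gt0// ltr_wpDl//.
  rewrite ler_pdivlMr ?ltr_wpDl// => he.
  by apply: le_trans he; rewrite mulrC ler_wpM2l// lerDl.
rewrite distrC /GRing.scale/= mulr1 (addrC h).
rewrite [X in X - d](_ : _ = h^-1 * (f (x + h) - f x)); last by [].
have -> : h^-1 * (f (x + h) - f x) - d = h^-1 * (f (x + h) - f x - d * h).
  by rewrite [RHS]mulrBr [h^-1 * (d * h)]mulrCA mulVf// mulr1.
rewrite normrM normfV ler_pdivrMl ?normr_gt0//.
apply: (le_trans (fC h)); apply: le_trans (ler_wpM2l (normr_ge0 h) he).
by rewrite -(real_normK (num_real h)) expr2 mulrCA.
Unshelve. all: by end_near. Qed.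

Definition posp {R : realType} (x : R) : R := Num.max 0 x.

Lemma pospP {R : realType} (x : R) :
  (x <= 0 /\ posp x = 0) \/ (0 <= x /\ posp x = x).
Proof.
rewrite /posp; case: (leP 0 x) => h; [right|left] => //; split=> //; exact: ltW.
Qed.

Lemma continuous_posp {R : realType} : continuous (@posp R).
Proof. by move=> x; apply: continuous_max; [exact: cst_continuous|]. Qed.

(* A C^1 step rising from 0 to 1 on [0, 2 d], with derivative [tent d]. *)
Definition ramp {R : realType} (d x : R) : R :=
  (posp x ^+ 2 - 2 * posp (x - d) ^+ 2 + posp (x - 2 * d) ^+ 2) / (2 * d ^+ 2).

(** The hat function on [0, 2 d] with peak 1 / d at d, hence of mass 1, written as a second
    difference of the positive part. *)
Definition tent {R : realType} (d x : R) : R :=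
  (posp x - 2 * posp (x - d) + posp (x - 2 * d)) / d ^+ 2.

(** The square of the positive part has derivative [2 * posp], which is 2-Lipschitz; so the
    first-order Taylor error is at most h^2. Such a uniform bound gives differentiability without
    singling out the knots of [ramp]. *)
Lemma posp_sqr_error {R : realType} (x h : R) :
  `|posp (x + h) ^+ 2 - posp x ^+ 2 - 2 * posp x * h| <= h ^+ 2.
Proof.
rewrite ler_norml.
case: (pospP x) => -[? ->]; case: (pospP (x + h)) => -[? ->];
  apply/andP; split; nra.
Qed.

Lemma continuous_tent {R : realType} (d : R) : continuous (tent d).
Proof.
have cs k : continuous (fun x : R => posp (x - k)).
  move=> x; apply: (@continuous_comp _ _ _ (fun x : R => x - k) (@posp R)).
    by apply: cvgB; [exact: cvg_id|exact: cvg_cst].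
  exact: continuous_posp.
move=> x; apply: cvgM; last exact: cvg_cst.
apply: cvgD; last exact: cs.
apply: cvgB; first exact: continuous_posp.
by apply: cvgM; [exact: cvg_cst|exact: cs].
Qed.

Lemma is_derive_ramp {R : realType} (d x : R) : 0 < d ->
  is_derive x 1 (ramp d) (tent d x).
Proof.
move=> d0.
(* The three errors enter with weights 1, 2, 1 and add up to 4 h^2, which is then divided by 2
   d^2. *)
apply: (@is_derive_quadratic_error _ _ _ _ (2 / d ^+ 2)) => h.
have := posp_sqr_error x h; have := posp_sqr_error (x - d) h.
have := posp_sqr_error (x - 2 * d) h.
rewrite /ramp /tent ![_ - _ + h]addrAC.
set a := posp (x + h); set b := posp (x + h - d); set c := posp (x + h - _).
set a' := posp x; set b' := posp (x - d); set c' := posp (x - 2 * d).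
move=> C B A.
have -> : forall p q r : R, p / (2 * d ^+ 2) - q / (2 * d ^+ 2) - r / d ^+ 2 * h
   = (p - q - 2 * r * h) / (2 * d ^+ 2).
  by move=> p q r; field; rewrite gt_eqF.
rewrite normrM (ger0_norm (_ : 0 <= (2 * d ^+ 2)^-1)); last first.
  by rewrite invr_ge0; nra.
rewrite [leRHS](_ : _ = (4 * h ^+ 2) / (2 * d ^+ 2)); last first.
  by field; rewrite gt_eqF.
apply: ler_wpM2r; first by rewrite invr_ge0; nra.
move: A B C; rewrite !ler_norml => /andP[? ?] /andP[? ?] /andP[? ?].
apply/andP; split; lra.
Qed.

Lemma tent_ge0 {R : realType} (d x : R) : 0 < d -> 0 <= tent d x.
Proof.
move=> d0.
rewrite /tent divr_ge0 ?sqr_ge0//.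
case: (pospP x) => -[? ->]; case: (pospP (x - d)) => -[? ->];
  case: (pospP (x - 2 * d)) => -[? ->]; lra.
Qed.

Lemma tent_eq0 {R : realType} (d x : R) : 0 < d -> x <= 0 \/ 2 * d <= x -> tent d x = 0.
Proof.
move=> d0.
move=> h; apply/eqP; rewrite /tent mulf_eq0; apply/orP; left; apply/eqP.
case: (pospP x) => -[? ->]; case: (pospP (x - d)) => -[? ->];
  case: (pospP (x - 2 * d)) => -[? ->]; case: h => ?;
  by apply: le_anti; apply/andP; split; lra.
Qed.

Lemma ramp_eq0 {R : realType} (d x : R) : 0 < d -> x <= 0 -> ramp d x = 0.
Proof.
move=> d0.
move=> h; apply/eqP; rewrite /ramp mulf_eq0; apply/orP; left; apply/eqP.
case: (pospP x) => -[? ->]; case: (pospP (x - d)) => -[? ->];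
  case: (pospP (x - 2 * d)) => -[? ->]; by apply: le_anti; apply/andP; split; nra.
Qed.

Lemma ramp_eq1 {R : realType} (d x : R) : 0 < d -> 2 * d <= x -> ramp d x = 1.
Proof.
move=> d0.
move=> h; rewrite /ramp.
have -> : posp x = x by
  case: (pospP x) => -[? ->]; by apply: le_anti; apply/andP; split; lra.
have -> : posp (x - d) = x - d by
  case: (pospP (x - d)) => -[? ->]; by apply: le_anti; apply/andP; split; lra.
have -> : posp (x - 2 * d) = x - 2 * d
  by case: (pospP (x - 2 * d)) => -[? ->]; by apply: le_anti; apply/andP; split; lra.
by field; rewrite gt_eqF.
Qed.

Lemma ramp_ge0 {R : realType} (d x : R) : 0 < d -> 0 <= ramp d x.
Proof.
move=> d0.
rewrite /ramp divr_ge0//; last nra.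
case: (pospP x) => -[? ->]; case: (pospP (x - d)) => -[? ->];
  case: (pospP (x - 2 * d)) => -[? ->]; nra.
Qed.

Lemma ramp_le1 {R : realType} (d x : R) : 0 < d -> ramp d x <= 1.
Proof.
move=> d0.
rewrite /ramp ler_pdivrMr; last nra.
case: (pospP x) => -[? ->]; case: (pospP (x - d)) => -[? ->];
  case: (pospP (x - 2 * d)) => -[? ->]; nra.
Qed.

Lemma continuous_itv_integrable {R : realType} (l : R) (f : R -> R) :
  {within `[0, l], continuous f} ->
  (@lebesgue_measure R).-integrable `]0, l[ (EFin \o f).
Proof.
move=> fc; apply: (@integrableS _ (measurableTypeR R) _ _ `[0, l]) => //.
  exact: subset_itv_oo_cc.
by apply: continuous_compact_integrable => //; exact: segment_compact.
Qed.

Lemma continuous_tent_shift {R : realType} (d a : R) :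
  continuous (fun x => tent d (x - a)).
Proof.
move=> x; apply: (@continuous_comp _ _ _ (fun x : R => x - a) (tent d)).
  by apply: cvgB; [exact: cvg_id|exact: cvg_cst].
exact: continuous_tent.
Qed.

Lemma is_derive_ramp_shift {R : realType} (d a x : R) : 0 < d ->
  is_derive x 1 (fun x => ramp d (x - a)) (tent d (x - a)).
Proof.
move=> d0; have := is_derive_ramp d (x - a) d0 => D.
have -> : (fun x => ramp d (x - a)) = ramp d \o (fun x => x - a) by [].
rewrite -[tent d (x - a)]mulr1; apply: is_derive1_comp.
by apply: is_derive_eq; rewrite oppr0 addr0.
Qed.

Lemma Rintegral_derive {R : realType} (l : R) (F f : R -> R) : 0 < l ->
  (forall x : R, is_derive x 1 F (f x)) -> continuous f ->
  \int[lebesgue_measure]_(t in `]0, l[) f t = F l - F 0.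
Proof.
move=> l0 dF cf.
have cf' : {within `[0, l], continuous f} by exact: continuous_subspaceT.
have cF : continuous F.
  by move=> x; apply/differentiable_continuous/derivable1_diffP; have [] := dF x.
rewrite Rintegral_itv_bndo_bndc; last exact: continuous_itv_integrable.
rewrite Rintegral_itv_obnd_cbnd; last first.
  apply: (@integrableS _ (measurableTypeR R) _ _ `[0, l]) => //.
    exact: subset_itv_oc_cc.
  by apply: continuous_compact_integrable => //; exact: segment_compact.
rewrite /Rintegral (continuous_FTC2 (F := F) l0 cf')//.
- split => [x _||]; first by have [] := dF x.
  + by apply: cvg_at_right_filter; exact: cF.
  + by apply: cvg_at_left_filter; exact: cF.
- by move=> x _; rewrite derive1E; apply: derive_val; exact: dF.
Qed.

(** The shifted hat is a nonnegative weight of mass 1 supported in [a, a + 2 d], so the integral is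
    an average of values that differ from [v] by at most [e]. *)
Lemma tent_average {R : realType} (u : R -> R) (l a d v e : R) :
  0 < d -> 0 < a -> a + 2 * d < l -> {within `[0, l], continuous u} ->
  (forall x, a <= x <= a + 2 * d -> `|u x - v| <= e) ->
  `|\int[lebesgue_measure]_(x in `]0, l[) (u x * tent d (x - a)) - v| <= e.
Proof.
move=> d0 a0 al cu uv.
have l0 : 0 < l by lra.
have cT : {within `[0, l], continuous (fun x : R => tent d (x - a))}.
  by apply: continuous_subspaceT; exact: continuous_tent_shift.
have cM (w : R -> R) : {within `[0, l], continuous w} ->
    {within `[0, l], continuous (fun x : R => w x * tent d (x - a))}.
  by move=> cw x; apply: cvgM; [exact: cw|exact: cT].
have cc (k : R) : {within `[0, l], continuous (fun=> k)}.
  by apply: continuous_subspaceT => ?; exact: cst_continuous.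
have T1 : \int[lebesgue_measure]_(x in `]0, l[) tent d (x - a) = 1.
  have -> := Rintegral_derive l (fun x => ramp d (x - a)) _ l0
    (fun x => is_derive_ramp_shift d a x d0) (continuous_tent_shift d a).
  rewrite ramp_eq1 ?ramp_eq0//; lra.
have intT := continuous_itv_integrable _ _ cT.
rewrite -[X in _ - X]mulr1 -T1 -RintegralZl// -RintegralB//; last 2 first.
  by apply: continuous_itv_integrable; exact: cM.
  by apply: continuous_itv_integrable; exact: cM.
have intuv : lebesgue_measure.-integrable `]0, l[
    (EFin \o (fun x => u x * tent d (x - a) - v * tent d (x - a))).
  apply: continuous_itv_integrable => x.
  by apply: cvgB; apply: cM.
apply: (le_trans (le_normr_Rintegral _ intuv)) => //.
rewrite -[leRHS]mulr1 -T1 -RintegralZl//; apply: le_Rintegral => //.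
- exact: (integrable_norm intuv).
- by apply: continuous_itv_integrable; exact: cM.
move=> x _; rewrite -mulrBl normrM (ger0_norm (tent_ge0 _ _ d0)).
have [xa|xa] := boolP (a <= x <= a + 2 * d).
  by rewrite ler_wpM2r ?tent_ge0 ?uv.
rewrite tent_eq0 ?mulr0//.
by move: xa; rewrite negb_and -!ltNge => /orP[?|?]; [left|right]; lra.
Qed.

Lemma within_itv_continuous {R : realType} (l : R) (u : R -> R) :
  (forall s e : R, 0 <= s <= l -> 0 < e -> exists2 d : R, 0 < d &
    forall x : R, 0 <= x <= l -> `|s - x| < d -> `|u s - u x| < e) ->
  {within `[0, l], continuous u}.
Proof.
move=> cu; apply/subspace_continuousP => x /=; rewrite in_itv/= => xl.
apply/cvgrPdist_lt => e e0.
have [d d0 ud] := cu x e xl e0.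
rewrite near_withinE; near=> y.
rewrite /= in_itv/= => yl; apply: ud yl _.
by near: y; exact: nbhsx_ballx.
Unshelve. all: by end_near. Qed.

Lemma lebesgue_measure_oo_lty {R : realType} (a b : R) :
  (lebesgue_measure (`]a, b[%classic : set R) < +oo)%E.
Proof. by rewrite lebesgue_measure_itv/=; case: ifP => _; rewrite ltry. Qed.

Lemma integrable_finite_cst {d} {T : measurableType d} {R : realType}
    (mu : {measure set T -> \bar R}) (D : set T) (k : R) :
  measurable D -> (mu D < +oo)%E -> mu.-integrable D (EFin \o (fun=> k)).
Proof.
move=> mD fD; apply/integrableP; split; first exact: measurable_cst.
by rewrite integral_cst// lte_mul_pinfty.
Qed.

(** The product is dominated by 1 + f^2, which is integrable because [D] has finite measure. *)
Lemma integrable_sqr_mul_bounded {d} {T : measurableType d} {R : realType}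
    (mu : {measure set T -> \bar R}) (D : set T) (f g : T -> R) :
  measurable D -> (mu D < +oo)%E ->
  measurable_fun D f -> measurable_fun D g -> (forall x, `|g x| <= 1) ->
  mu.-integrable D (EFin \o (fun x => f x ^+ 2)) ->
  mu.-integrable D (EFin \o (fun x => f x * g x)).
Proof.
move=> mD fD mf mg g1 f2.
have f21 := integrableD mD (integrable_finite_cst mu D 1 mD fD) f2.
apply: (le_integrable mD _ _ f21).
  by apply/measurable_EFinP; exact: measurable_funM.
move=> x _; rewrite /= lee_fin normrM.
apply: (@le_trans _ _ `|f x|).
  by rewrite -[leRHS]mulr1 ler_wpM2l.
rewrite [leRHS]ger0_norm ?addr_ge0 ?sqr_ge0// -(real_normK (num_real (f x))).
nra.
Qed.

(* The Cauchy-Schwarz bound in its weighted AM-GM form: unlike the former, this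
   adds up along a chain of segments, and [c] is optimised only at the end. *)
Lemma H1_interval_increment {R : realType} (l : R) (u u' : R -> R) (s t c : R) :
  H1_interval l u u' ->
  (forall s e : R, 0 <= s <= l -> 0 < e -> exists2 d : R, 0 < d &
    forall x : R, 0 <= x <= l -> `|s - x| < d -> `|u s - u x| < e) ->
  0 <= s -> s <= t -> t <= l -> 0 < c ->
  2 * `|u t - u s| <=
    c * (t - s) + c^-1 * \int[lebesgue_measure]_(x in `]s, t[) (u' x ^+ 2).
Proof.
move=> [_ [mu' fu'] weak] cu s0 st tl c0.
have int2 : (@lebesgue_measure R).-integrable `]0, l[ (EFin \o (fun x => u' x ^+ 2)).
  apply/integrableP; split.
    by apply/measurable_EFinP; exact: measurable_funX.
  under eq_integral do rewrite /= ger0_norm ?sqr_ge0//.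
  exact: fu'.
move: st; rewrite le_eqVlt => /orP[/eqP <-|st].
  rewrite subrr normr0 mulr0 subrr mulr0 add0r.
  apply: mulr_ge0; first by rewrite invr_ge0 ltW.
  by apply: Rintegral_ge0 => x _; exact: sqr_ge0.
have cwu := within_itv_continuous l u cu.
(* Each endpoint value is replaced by an average at a cost of e / 4; the two costs, doubled, make up
   [e]. *)
apply/ler_addgt0Pr => e e0.
have e4 : 0 < e / 4 by lra.
have [d1 d10 ud1] := cu s (e / 4) (ltac:(lra)) e4.
have [d2 d20 ud2] := cu t (e / 4) (ltac:(lra)) e4.
(* The averaging windows reach as far as 3 d from [s] and from [t]; the divisor 8 makes them
   disjoint and keeps them strictly within the radii of continuity. *)
pose d : R := Num.min (Num.min d1 d2) (t - s) / 8.
have dm : 0 < d /\ [/\ 8 * d <= d1, 8 * d <= d2 & 8 * d <= t - s].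
  rewrite /d; have : 0 < Num.min (Num.min d1 d2) (t - s).
    by rewrite !lt_min d10 d20 subr_gt0.
  have : Num.min (Num.min d1 d2) (t - s) <= d1 by rewrite !ge_min lexx.
  have : Num.min (Num.min d1 d2) (t - s) <= d2 by rewrite !ge_min lexx !orbT.
  have : Num.min (Num.min d1 d2) (t - s) <= t - s by rewrite ge_min lexx orbT.
  by move: (Num.min _ _) => m *; split; [lra|split; lra].
move: dm => [d0 [dd1 dd2 dts]].
(* [phi] rises from 0 to 1 on [s + d, s + 3 d] and falls back on [t - 3 d, t - d]. The margin [d] on
   each side keeps its support inside (0, l) even when s = 0 or t = l. *)
pose a := s + d; pose b := t - 3 * d.
pose phi (x : R) : R := ramp d (x - a) - ramp d (x - b).
pose phi' (x : R) : R := tent d (x - a) - tent d (x - b).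
have dphi (x : R) : is_derive x 1 phi (phi' x).
  by apply: is_deriveB; exact: is_derive_ramp_shift.
have cphi' : continuous phi'.
  by move=> x; apply: cvgB; exact: continuous_tent_shift.
have Dphi : derive1 phi = phi'.
  by apply/funext => x; rewrite derive1E; apply: derive_val.
have cphi : continuous phi.
  by move=> x; apply/differentiable_continuous/derivable1_diffP; have [] := dphi x.
have phi1 (x : R) : `|phi x| <= 1.
  have := ramp_ge0 d (x - a) d0; have := ramp_ge0 d (x - b) d0.
  have := ramp_le1 d (x - a) d0; have := ramp_le1 d (x - b) d0.
  by rewrite /phi ler_norml => *; apply/andP; split; lra.
have phi0 (x : R) : phi x != 0 -> a <= x <= b + 2 * d.
  apply: contraNT; rewrite negb_and -!ltNge => /orP[xa|xb]; apply/eqP; rewrite /phi.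
    by rewrite !ramp_eq0 ?subrr//; rewrite /b /a in xa *; lra.
  by rewrite !ramp_eq1 ?subrr//; rewrite /b /a in xb *; lra.
have test : test_function l phi.
  split; first by move=> x; have [] := dphi x.
    by rewrite Dphi.
  exists a, (b + 2 * d); split; [rewrite /a; lra|rewrite /b; lra|exact: phi0].
have cM (y : R) : {within `[0, l], continuous (fun x => u x * tent d (x - y))}.
  have ct := continuous_subspaceT (A := `[0, l]%classic) (continuous_tent_shift d y).
  by move=> x; apply: cvgM; [exact: cwu|exact: ct].
have := weak _ test; rewrite Dphi.
pose U (y : R) : R := \int[lebesgue_measure]_(x in `]0, l[) (u x * tent d (x - y)).
have -> : \int[lebesgue_measure]_(x in `]0, l[) (u x * phi' x) = U a - U b.
  rewrite /U -RintegralB//.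
  - by apply: eq_Rintegral => x _; rewrite mulrBr.
  - by apply: continuous_itv_integrable; exact: cM.
  - by apply: continuous_itv_integrable; exact: cM.
have Us : `|U a - u s| <= e / 4.
  apply: tent_average => //; [rewrite /a; lra|rewrite /a; lra|] => x xa.
  rewrite distrC ltW// ud1//; first by rewrite /a in xa; lra.
  by rewrite /a in xa; rewrite ltr_norml; lra.
have Ut : `|U b - u t| <= e / 4.
  apply: tent_average => //; [rewrite /b; lra|rewrite /b; lra|] => x xb.
  rewrite distrC ltW// ud2//; first by rewrite /b in xb; lra.
  by rewrite /b in xb; rewrite ltr_norml; lra.
move: Us Ut; move: (U a) (U b) => Ua Ub Us Ut weq.
have intp : (@lebesgue_measure R).-integrable `]0, l[ (EFin \o (fun x => u' x * phi x)).
  apply: integrable_sqr_mul_bounded => //; first exact: lebesgue_measure_oo_lty.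
  by apply: measurable_funTS; exact: continuous_measurable_fun.
have sub : `]s, t[%classic `<=` (`]0, l[%classic : set R).
  by move=> x /=; rewrite !in_itv/= => xs; lra.
have W : 2 * `|Ub - Ua| <= c * (t - s) +
    c^-1 * \int[lebesgue_measure]_(x in `]s, t[) (u' x ^+ 2).
  rewrite distrC weq normrN.
  (* [phi] vanishes outside ]s, t[, so only the energy of this segment is picked up. *)
  rewrite -[X in 2 * `|X|](_ :
    \int[lebesgue_measure]_(x in `]s, t[) (u' x * phi x) = _); last first.
    rewrite [LHS]Rintegral_mkcond [RHS]Rintegral_mkcond; apply: eq_Rintegral => x _.
    rewrite !patchE; case: ifPn => [xs|xs].
      by rewrite ifT//; move: xs; rewrite !inE; exact: sub.
    case: ifPn => // _; apply/eqP; rewrite eq_sym mulf_eq0; apply/orP; right.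
    apply: contraNT xs => /phi0; rewrite inE/= in_itv/= /a /b => xs; lra.
  have restr (g : R -> R) : (@lebesgue_measure R).-integrable `]0, l[ (EFin \o g) ->
      (@lebesgue_measure R).-integrable `]s, t[ (EFin \o g).
    by apply: integrableS.
  have intst := restr _ intp.
  have int2st := restr _ int2.
  have intc : (@lebesgue_measure R).-integrable `]s, t[ (EFin \o (fun=> c)).
    by apply: integrable_finite_cst => //; exact: lebesgue_measure_oo_lty.
  have : 2 * `|\int[lebesgue_measure]_(x in `]s, t[) (u' x * phi x)| <=
      \int[lebesgue_measure]_(x in `]s, t[) (2 * `|u' x * phi x|).
    rewrite RintegralZl//; last exact: (integrable_norm intst).
    by rewrite ler_pM2l//; exact: le_normr_Rintegral.
  move=> /le_trans; apply.
  have intB : (@lebesgue_measure R).-integrable `]s, t[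
      (EFin \o (fun x => c^-1 * u' x ^+ 2)).
    exact: (integrableZl _ c^-1 int2st).
  have -> : c * (t - s) = \int[lebesgue_measure]_(x in `]s, t[) c.
    have mst : fine (lebesgue_measure (`]s, t[%classic : set R)) = t - s.
      by rewrite lebesgue_measure_itv/= lte_fin st.
    by rewrite Rintegral_cst// -mst.
  rewrite -RintegralZl// -RintegralD//.
  apply: le_Rintegral => //.
  - exact: (integrableZl _ 2 (integrable_norm intst)).
  - exact: (integrableD _ intc intB).
  move=> x _; rewrite normrM.
  have p1 := phi1 x.
  (* This is (c - |u'|)^2 >= 0, divided by [c]. *)
  have : 2 * `|u' x| <= c + c^-1 * u' x ^+ 2.
    rewrite -(ler_pM2l c0) mulrDr mulVKf ?gt_eqF// -(real_normK (num_real (u' x))).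
    have := sqr_ge0 (c - `|u' x|); nra.
  apply: le_trans; rewrite ler_pM2l// -[leRHS]mulr1 ler_wpM2l//.
have : `|u t - u s| <= `|Ub - Ua| + e / 2.
  have : u t - u s = (Ub - Ua) + ((u t - Ub) - (u s - Ua)) by ring.
  move=> ->; apply: (le_trans (ler_normD _ _)); rewrite lerD2l.
  by move: Us Ut; rewrite !ler_norml; lra.
lra.
Qed.

(** * Paths as chains of disjoint segments *)

Section chains.
Context {R : realType} (G : metric_graph R).

(** An edge with the parameters of departure and arrival, in the order of travel; the second may be
    smaller than the first. *)
Definition segment : Type := (mg_edge G * (R * R))%type.

Definition segment_length (a : segment) : R := `|a.2.1 - a.2.2|.

Definition in_edge (e : mg_edge G) (t : R) := 0 <= t <= mg_length e.

Fixpoint chain (p : graph_point G) (L : seq segment) (q : graph_point G) : Prop :=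
  if L is (e, (s, t)) :: L' then
    [/\ in_edge e s, in_edge e t, p = edge_point e s & chain (edge_point e t) L' q]
  else p = q.

Definition chain_length (L : seq segment) : R := \sum_(a <- L) segment_length a.

(** Disjointness of the closed parameter intervals: segments of one edge that merely touch are not
    separated and get merged too. Segments meeting only at a vertex shared by distinct edges are
    separated, which is harmless since vertices carry no measure. *)
Definition separated (a b : segment) : bool :=
  [|| a.1 != b.1, Num.max a.2.1 a.2.2 < Num.min b.2.1 b.2.2 |
      Num.max b.2.1 b.2.2 < Num.min a.2.1 a.2.2].

Lemma graph_path_chain p q l : graph_path p q l ->
  exists2 L, chain p L q & chain_length L = l.
Proof.
elim=> {p q l} [p|e s t q l sl tl _ [L cL <-]].
  by exists [::]; rewrite // /chain_length big_nil.
by exists ((e, (s, t)) :: L) => //; rewrite /chain_length big_cons.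
Qed.

Lemma chain_cat p L1 L2 q :
  chain p (L1 ++ L2) q <-> exists2 r, chain p L1 r & chain r L2 q.
Proof.
elim: L1 p => [|[e [s t]] L1 IH] p /=.
  by split => [?|[r ->]//]; exists p.
split.
  by move=> [es et -> /IH[r c1 c2]]; exists r.
by move=> [r [es et -> c1] c2]; split => //; apply/IH; exists r.
Qed.

Lemma not_pairwiseE {T : Type} (r : rel T) (L : seq T) : ~~ pairwise r L ->
  exists A B C a b, L = A ++ a :: B ++ b :: C /\ ~~ r a b.
Proof.
elim: L => [//|x L IH] /=; rewrite negb_and => /orP[|/IH].
  move=> xL; suff [B [C [b [-> rb]]]] : exists B C b, L = B ++ b :: C /\ ~~ r x b.
    by exists [::], B, C, x, b.
  elim: L xL {IH} => [//|y L IH] /=; rewrite negb_and => /orP[ry|/IH].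
    by exists [::], L, y.
  by move=> [B [C [b [-> rb]]]]; exists (y :: B), C, b.
by move=> [A [B [C [a [b [-> rab]]]]]]; exists (x :: A), B, C, a, b.
Qed.

(* Two overlapping segments of one edge, together with everything travelled
   between them, are replaced by the single segment from the start of the first
   to the end of the second. *)
Lemma chain_merge p q A B C (a b : segment) :
  ~~ separated a b -> chain p (A ++ a :: B ++ b :: C) q ->
  exists c : segment, chain p (A ++ c :: C) q /\
    chain_length (A ++ c :: C) <= chain_length (A ++ a :: B ++ b :: C).
Proof.
case: a => e [s t]; case: b => e' [s' t'].
rewrite /separated !negb_or negbK/= => /andP[/eqP <-{e'}].
rewrite -!leNgt => /andP[ov1 ov2] /chain_cat[r c1 /= [es _ er /chain_cat[r' _]]].
move=> /= [_ et' _ c2]; exists (e, (s, t')); split.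
  by apply/chain_cat; exists r.
rewrite /chain_length !big_cat/= !big_cons big_cat/= big_cons lerD2l.
rewrite !addrA lerD2r.
have B0 : 0 <= \sum_(i <- B) segment_length i by apply: sumr_ge0 => i _; exact: normr_ge0.
move: (\sum_(i <- B) _) B0 => b b0.
(* A parameter common to both intervals splits the distance from [s] to [t'] into a part of the
   first segment and a part of the second; whatever was travelled in between has nonnegative
   length. *)
suff : `|s - t'| <= `|s - t| + `|s' - t'| by rewrite /segment_length/=; lra.
move: ov1 ov2; rewrite !ge_min !le_max => ov1 ov2.
have ? := ler_norm (s - t); have ? := ler_norm (s' - t').
have ? := lerNnormlW (lexx `|s - t|); have ? := lerNnormlW (lexx `|s' - t'|).
rewrite ler_norml.
move: ov1 ov2 => /orP[/orP[?|?]|/orP[?|?]] /orP[/orP[?|?]|/orP[?|?]];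
  apply/andP; split; lra.
Qed.

(** Each merge removes at least one segment and does not increase the length, so induction on the
    number of segments terminates. *)
Lemma chain_separated p q L : chain p L q ->
  exists L', [/\ chain p L' q, chain_length L' <= chain_length L & pairwise separated L'].
Proof.
have [n] := ubnP (size L); elim: n L => // n IH L sL cL.
have [pL|/not_pairwiseE[A [B [C [a [b [LE sab]]]]]]] := boolP (pairwise separated L).
  by exists L.
rewrite LE in cL sL; have [c [cc lc]] := chain_merge _ _ _ _ _ _ _ sab cL.
have [|L' [cL' lL' pL']] := IH _ _ cc.
  rewrite ltnS in sL; apply: leq_trans _ sL.
  by rewrite !size_cat/= size_cat/= ltn_add2l ltnS leq_addl.
by exists L'; split => //; rewrite LE; exact: le_trans lL' lc.
Qed.

End chains.

(** * Integration on the graph *)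

Lemma ge0_integral_mrestr {d} {T : measurableType d} {R : realType}
    (mu : {measure set T -> \bar R}) (D : set T) (mD : measurable D) (f : T -> \bar R) :
  measurable_fun setT f -> (forall x, (0 <= f x)%E) ->
  (\int[mrestr mu mD]_x f x = \int[mu]_(x in D) f x)%E.
Proof.
move=> mf f0; have mDc : measurable (~` D) by exact: measurableC.
rewrite -(setUv D) ge0_integral_setU//; last 2 first.
- by rewrite setUv.
- by apply/disj_setPS; rewrite setICr.
rewrite [X in (_ + X)%E](_ : _ = 0%E) ?adde0; last first.
  apply: null_set_integral => //; first exact: measurable_funTS.
  by rewrite /= /mrestr setIC setICr measure0.
by apply: eq_measure_integral => A mA AD; rewrite /= /mrestr setIidl.
Qed.

(** Turns a sum over edges into a series over their codes, codes of no edge counting 0, so that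
    integration against a series of measures applies. *)
Lemma nneseries_pickle_inv {R : realType} (T : countType) (a : T -> \bar R) :
  (forall x, (0 <= a x)%E) ->
  (\sum_(0 <= n <oo) oapp a 0 (pickle_inv n) = \esum_(x in [set: T]) a x)%E.
Proof.
move=> a0; rewrite nneseries_esumT; last by move=> n; case: pickle_inv.
pose b (n : nat) := oapp a 0%E (pickle_inv n).
rewrite -[LHS]/(\esum_(n in [set: nat]) b n)%E.
rewrite -[RHS](_ : \esum_(x in [set: T]) b (pickle x) = _)%E; last first.
  by apply: eq_esum => x _; rewrite /b pickleK_inv.
rewrite -(esum_image [set: T] pickle b); last first.
  by move=> x y _ _ /(congr1 (@pickle_inv T)); rewrite !pickleK_inv => -[].
rewrite [RHS]esum_mkcond; apply: eq_esum => n _; case: ifPn => // /negP nT.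
rewrite /b; case E : (pickle_inv n) => [x|//]; case: nT; rewrite inE.
by exists x => //; have := @pickle_invK T n; rewrite E.
Qed.

Section graph_integral.
Context {R : realType} (G : metric_graph R).

Lemma measurable_edge_point (e : mg_edge G) :
  measurable_fun [set: measurableTypeR R] (edge_point e).
Proof. by move=> _ A mA; rewrite setTI; exact: mA. Qed.

Definition edge_measure (e : mg_edge G) : {measure set (graph_point G) -> \bar R}.
refine (pushforward (mrestr (@lebesgue_measure R) (measurable_itv `]0, mg_length e[))
  (edge_point e)).
exact: measurable_edge_point.
Defined.

Lemma edge_integral (e : mg_edge G) (g : graph_point G -> \bar R) :
  measurable_fun setT g -> (forall x, (0 <= g x)%E) ->
  (\int[edge_measure e]_x g x =
   \int[@lebesgue_measure R]_(t in `]0%R, mg_length e[) g (edge_point e t))%E.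
Proof.
move=> mg g0; rewrite ge0_integral_pushforward//; last exact: measurable_edge_point.
rewrite preimage_setT ge0_integral_mrestr//; last by move=> x; exact: g0.
by apply: measurableT_comp => //; exact: measurable_edge_point.
Qed.

(** The graph measure is the series of the [edge_measure]s along the codes of the edges, with the
    zero measure at codes of no edge. *)
Lemma ge0_graph_integralE (g : graph_point G -> \bar R) :
  measurable_fun setT g -> (forall x, (0 <= g x)%E) ->
  (\int[@graph_measure R G]_x g x = \esum_(e in [set: mg_edge G])
     \int[@lebesgue_measure R]_(t in `]0%R, mg_length e[) g (edge_point e t))%E.
Proof.
move=> mg g0.
pose m (n : nat) : {measure set (graph_point G) -> \bar R} :=
  if pickle_inv n is Some e then edge_measure e else mzero.
rewrite (eq_measure_integral (mseries m 0)); last first.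
  move=> A mA _; rewrite /mseries/= /graph_measure.
  rewrite -(nneseries_pickle_inv (mg_edge G)); last by move=> e; exact: measure_ge0.
  apply: eq_eseriesr => n _; rewrite /m; case: pickle_inv => //= e.
  by rewrite /pushforward /mrestr setIC.
rewrite ge0_integral_measure_series//.
rewrite -(nneseries_pickle_inv (mg_edge G)); last by move=> e; exact: integral_ge0.
apply: eq_eseriesr => n _; rewrite /m; case: pickle_inv => [e|] /=.
  exact: edge_integral.
by rewrite integral_measure_zero.
Qed.

End graph_integral.

Section coordinates.
Context {R : realType} {G : metric_graph R}.

(** A left inverse of the edge parametrisations on open edges; it shows that they are injective
    there and that distinct edges have disjoint interiors. *)
Definition edge_coord (x : graph_point G) : option (mg_edge G * R) :=
  if x is Interior e t then Some (e, val t) else None.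

Lemma edge_coordE (e : mg_edge G) (t : R) :
  edge_coord (edge_point e t) = if 0 < t < mg_length e then Some (e, t) else None.
Proof.
rewrite /edge_point; case: insubP => [u -> <- //|/negbTE ->].
by case: ifP.
Qed.

(** Outside (0, l) the map [edge_point e] is clamped to an endpoint, so the composite is constant on
    each of the two remaining half-lines. *)
Lemma edge_point_measurable_fun (f : graph_point G -> R) :
  (forall e, measurable_fun `]0, mg_length e[ (f \o edge_point e)) ->
  measurable_fun setT f.
Proof.
move=> mf _ Y mY; rewrite setTI -[measurable _]/(graph_measurable _) => e.
suff : measurable_fun [set: measurableTypeR R] (f \o edge_point e).
  by move=> /(_ measurableT Y mY); rewrite setTI.
have -> : [set: measurableTypeR R] =
    `]-oo, 0] `|` (`]0, mg_length e[ `|` `[mg_length e, +oo[).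
  apply/seteqP; split => [x _|//] /=; rewrite !in_itv/= andbT.
  have [|?] := leP x 0; first by left.
  by right; have [?|] := ltP x (mg_length e); [left|right].
have l0 := mg_length_gt0 e.
apply/measurable_funU => //; first exact: measurableU.
split; last apply/measurable_funU => //; last split => //.
- apply: (eq_measurable_fun (cst (f (Vertex (mg_src e))))) => //.
  move=> t; rewrite inE/= in_itv/= => t0; rewrite /edge_point insubF ?t0//.
  by rewrite ltNge t0.
- exact: mf.
- apply: (eq_measurable_fun (cst (f (Vertex (mg_tgt e))))) => //.
  move=> t; rewrite inE/= in_itv/= ?andbT => lt; rewrite /edge_point insubF.
    by rewrite ifF//; apply/negbTE; rewrite -ltNge; exact: lt_le_trans l0 lt.
  by rewrite [X in _ && X]ltNge lt andbF.
Qed.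

(** The one-segment path from [s] to [x] bounds the graph distance by |s - x|. *)
Lemma continuous_on_edge (f : graph_point G -> R) (e : mg_edge G) :
  continuous_on_graph f ->
  forall s eps : R, 0 <= s <= mg_length e -> 0 < eps -> exists2 d : R, 0 < d &
    forall x : R, 0 <= x <= mg_length e -> `|s - x| < d ->
      `|(f \o edge_point e) s - (f \o edge_point e) x| < eps.
Proof.
move=> cf s eps sl e0; have [d d0 fd] := cf (edge_point e s) eps e0.
exists d => // x xl sx; apply: fd; apply: le_lt_trans (_ : _ <= `|s - x|%:E)%E _.
  apply: ereal_inf_lbound; exists `|s - x| => //=.
  rewrite -[X in graph_path _ _ X]addr0; apply: graph_path_cons => //.
  exact: graph_path_nil.
by rewrite lte_fin.
Qed.

Definition segment_interior (a : segment G) : set R :=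
  `]Num.min a.2.1 a.2.2, Num.max a.2.1 a.2.2[%classic.

(** Intersecting with the open edge discards parameters that would be clamped to a vertex, so
    preimages under [edge_point] can be computed for arbitrary parameters. *)
Definition segment_set (a : segment G) : set (graph_point G) :=
  edge_point a.1 @` (segment_interior a `&` `]0, mg_length a.1[%classic).

Lemma segment_setE (a : segment G) x : segment_set a x <->
  exists2 t, (segment_interior a `&` `]0, mg_length a.1[%classic) t &
    edge_coord x = Some (a.1, t).
Proof.
split => [[t ta <-]|[t ta]].
  exists t => //; rewrite edge_coordE ifT//.
  by move: ta => [_] /=; rewrite in_itv/=.
case: a ta => e' st ta; case: x => // e u [ee ut]; subst e'; subst t.
by exists (val u) => //; rewrite /edge_point valK.
Qed.

Lemma preimage_segment_set (a : segment G) (e : mg_edge G) :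
  edge_point e @^-1` segment_set a =
  if e == a.1 then segment_interior a `&` `]0, mg_length a.1[%classic else set0.
Proof.
apply/seteqP; split => t /=.
  move/segment_setE => [t' t'a]; rewrite edge_coordE; case: ifP => // _ [-> ->].
  by rewrite eqxx.
by case: eqP => [-> ta|//]; exists t.
Qed.

Lemma measurable_segment_set (a : segment G) : measurable (segment_set a).
Proof.
rewrite -[measurable _]/(graph_measurable _) => e.
rewrite preimage_segment_set; case: ifP => // _.
by apply: measurableI; exact: measurable_itv.
Qed.

End coordinates.

(** * The Poincare inequality *)

Lemma H1_interval_increment_sym {R : realType} (l : R) (u u' : R -> R) (s t c : R) :
  H1_interval l u u' ->
  (forall s e : R, 0 <= s <= l -> 0 < e -> exists2 d : R, 0 < d &
    forall x : R, 0 <= x <= l -> `|s - x| < d -> `|u s - u x| < e) ->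
  0 <= s <= l -> 0 <= t <= l -> 0 < c ->
  2 * `|u s - u t| <= c * `|s - t| +
    c^-1 * \int[lebesgue_measure]_(x in `]Num.min s t, Num.max s t[) (u' x ^+ 2).
Proof.
move=> Hu cu /andP[s0 sl] /andP[t0 tl] c0; have [st|/ltW ts] := leP s t.
  rewrite distrC [`|s - t|]distrC (ger0_norm (_ : 0 <= t - s)) ?subr_ge0//.
  exact: (H1_interval_increment l).
rewrite [`|s - t|]ger0_norm ?subr_ge0//.
exact: (H1_interval_increment l).
Qed.

Section segments.
Context {R : realType} {G : metric_graph R}.

(** Of the sum over edges that computes the right-hand side, only the term of the edge [a.1] is
    kept. *)
Lemma segment_set_integral (a : segment G) (g : graph_point G -> \bar R) :
  in_edge G a.1 a.2.1 -> in_edge G a.1 a.2.2 ->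
  measurable_fun setT g -> (forall x, (0 <= g x)%E) ->
  (\int[@lebesgue_measure R]_(t in segment_interior a) g (edge_point a.1 t) <=
   \int[@graph_measure R G]_(x in segment_set a) g x)%E.
Proof.
move=> /andP[s0 sl] /andP[t0 tl] mg g0.
have sub : segment_interior a `<=` `]0, mg_length a.1[%classic.
  move=> x; rewrite /segment_interior/= !in_itv/= gt_min lt_max.
  by move=> /andP[/orP[h1|h1] /orP[h2|h2]]; lra.
rewrite [leRHS]integral_mkcond ge0_graph_integralE; last 2 first.
- apply/(measurable_restrictT _ _).1 => //; first exact: measurable_segment_set.
  exact: measurable_funTS.
- by move=> x; rewrite patchE; case: ifP.
apply: esum_ge; exists [set a.1]; first by split.
rewrite fsbig_set1 [leLHS](_ : _ = \int[@lebesgue_measure R]_(t in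
  `]0%R, mg_length a.1[) ((fun t => g (edge_point a.1 t)) \_ (segment_interior a) t))%E; last first.
  by rewrite -integral_mkcondr setIidr.
rewrite le_eqVlt; apply/orP; left; apply/eqP; apply: eq_integral => t.
rewrite inE/= => tl'; rewrite !patchE.
suff -> : (edge_point a.1 t \in segment_set a) = (t \in segment_interior a) by [].
apply/idP/idP; rewrite !inE => ta.
  have : (edge_point a.1 @^-1` segment_set a) t by [].
  by rewrite preimage_segment_set eqxx => -[].
by exists t.
Qed.

Lemma separated_disjoint (a b : segment G) : separated G a b ->
  segment_set a `&` segment_set b = set0.
Proof.
move=> sab; apply/seteqP; split => // x [].
move=> /segment_setE[t [ta _] xt] /segment_setE[t' [tb _]].
rewrite xt => -[ab tt']; rewrite -tt' in tb; move: ta tb sab.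
rewrite /segment_interior /= !in_itv/= /separated ab eqxx/= => /andP[h1 h2] /andP[h3 h4].
move=> /orP[h|h].
  by have := lt_trans (lt_trans h2 h) h3; rewrite ltxx.
by have := lt_trans (lt_trans h4 h) h1; rewrite ltxx.
Qed.

Lemma separated_integral (L : seq (segment G)) (g : graph_point G -> \bar R) :
  pairwise (separated G) L ->
  {in L, forall a, in_edge G a.1 a.2.1 /\ in_edge G a.1 a.2.2} ->
  measurable_fun setT g -> (forall x, (0 <= g x)%E) ->
  (\sum_(a <- L) \int[@lebesgue_measure R]_(t in segment_interior a)
      g (edge_point a.1 t) <=
   \int[@graph_measure R G]_x g x)%E.
Proof.
move=> sL eL mg g0; pose S (L : seq (segment G)) := \bigcup_(a in [set` L]) segment_set a.
have mS L' : measurable (S L').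
  rewrite /S bigcup_seq; apply: bigsetU_measurable => a _.
  exact: measurable_segment_set.
apply: (@le_trans _ _ (\int[@graph_measure R G]_(x in S L) g x)%E); last first.
  by apply: ge0_subset_integral.
elim: L sL eL => [|a L IH] /=; first by rewrite big_nil integral_ge0.
move=> /andP[aL sL] eL; rewrite big_cons.
have -> : S (a :: L) = segment_set a `|` S L.
  by rewrite /S !bigcup_seq big_cons.
rewrite ge0_integral_setU//; last 3 first.
- exact: measurable_segment_set.
- exact: measurable_funTS.
- apply/disj_setPS => x [xa [b /= bL xb]].
  have : (segment_set a `&` segment_set b) x by [].
  by rewrite separated_disjoint//; move/allP: aL; apply.
apply: leeD; last first.
  by apply: IH => // b bL; apply: eL; rewrite inE bL orbT.
have [] := eL a; first by rewrite inE eqxx.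
by move=> ? ?; exact: segment_set_integral.
Qed.

Lemma chain_in_edge p (L : seq (segment G)) q : chain G p L q ->
  {in L, forall a, in_edge G a.1 a.2.1 /\ in_edge G a.1 a.2.2}.
Proof.
elim: L p => [//|[e [s t]] L IH] p /= [es et _ cL] a.
by rewrite inE => /orP[/eqP ->//|]; exact: IH cL a.
Qed.

Lemma chain_increment p (L : seq (segment G)) q (f f' : graph_point G -> R) (c : R) :
  H1_graph f f' -> chain G p L q -> 0 < c ->
  2 * `|f p - f q| <= c * chain_length G L + c^-1 *
    \sum_(a <- L) \int[lebesgue_measure]_(t in segment_interior a)
      (f' (edge_point a.1 t) ^+ 2).
Proof.
move=> [cf Hf _] + c0; elim: L p => [|[e [s t]] L IH] p /=.
  by move=> ->; rewrite subrr normr0 /chain_length !big_nil !mulr0 addr0.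
move=> [es et -> /IH {}IH]; rewrite /chain_length !big_cons/=.
have := H1_interval_increment_sym _ _ _ s t c (Hf e) (continuous_on_edge f e cf) es et c0.
have := ler_distD (f (edge_point e t)) (f (edge_point e s)) (f q).
move: IH; rewrite /chain_length /segment_length /segment_interior/=.
move: (\sum_(_ <- _) _) (\sum_(_ <- _) _) (Rintegral _ _ _) => x y z.
rewrite !mulrDr; lra.
Qed.

End segments.

Lemma quadratic_from_AMGM {R : realType} (a D E : R) :
  0 <= a -> 0 < D -> 0 <= E -> (forall c, 0 < c -> 2 * a <= c * D + c^-1 * E) ->
  a ^+ 2 <= D * E.
Proof.
move=> a0 D0 E0 H; move: a0; rewrite le_eqVlt => /orP[/eqP <-|a0].
  by rewrite expr0n/= mulr_ge0// ltW.
(* The choice c = a / D makes the first term equal to [a]. The true optimum, the square root of E /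
   D, would degenerate at E = 0. *)
have := H _ (divr_gt0 a0 D0); rewrite invf_div divfK ?gt_eqF// => h.
have {h} : a <= D / a * E by lra.
by rewrite mulrAC ler_pdivlMr// expr2.
Qed.

Section energy.
Context {R : realType} {G : metric_graph R}.
Local Notation mu := (@graph_measure R G : {measure set (graph_point G) -> \bar R}).

Lemma H1_graph_measurable (f f' : graph_point G -> R) : H1_graph f f' ->
  measurable_fun setT f /\ measurable_fun setT f'.
Proof.
move=> [_ Hf _]; split; apply: edge_point_measurable_fun => e.
  by have [[]] := Hf e.
by have [_ []] := Hf e.
Qed.

Lemma H1_graph_integrable (f f' : graph_point G -> R) : H1_graph f f' ->
  mu.-integrable setT (EFin \o (fun x => f x ^+ 2)) /\
  mu.-integrable setT (EFin \o (fun x => f' x ^+ 2)).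
Proof.
move=> Hf; have [mf mf'] := H1_graph_measurable _ _ Hf.
have mf2 := measurable_funX 2 mf; have mf'2 := measurable_funX 2 mf'.
have iff' : mu.-integrable setT (EFin \o (fun x => f x ^+ 2 + f' x ^+ 2)).
  apply/integrableP; split; first by apply/measurable_EFinP; exact: measurable_funD.
  under eq_integral do rewrite /= ger0_norm ?addr_ge0 ?sqr_ge0//.
  rewrite ge0_graph_integralE; first by case: Hf.
    by apply/measurable_EFinP; exact: measurable_funD.
  by move=> x; rewrite lee_fin addr_ge0 ?sqr_ge0.
split.
  apply: (le_integrable _ _ _ iff') => //; first exact/measurable_EFinP.
  by move=> x _; rewrite /= lee_fin !ger0_norm ?addr_ge0 ?sqr_ge0// lerDl sqr_ge0.
apply: (le_integrable _ _ _ iff') => //; first exact/measurable_EFinP.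
by move=> x _; rewrite /= lee_fin !ger0_norm ?addr_ge0 ?sqr_ge0// lerDr sqr_ge0.
Qed.

Lemma separated_energy (L : seq (segment G)) (f f' : graph_point G -> R) :
  H1_graph f f' -> pairwise (separated G) L ->
  {in L, forall a, in_edge G a.1 a.2.1 /\ in_edge G a.1 a.2.2} ->
  \sum_(a <- L) \int[lebesgue_measure]_(t in segment_interior a)
      (f' (edge_point a.1 t) ^+ 2)
  <= \int[mu]_x (f' x ^+ 2).
Proof.
move=> Hf sL eL; have [_ mf'] := H1_graph_measurable _ _ Hf.
have [_ if'] := H1_graph_integrable _ _ Hf.
rewrite -lee_fin [leRHS]fineK; last exact: integrable_fin_num.
have mf'2 : measurable_fun setT (fun x => (f' x ^+ 2)%:E).
  by apply/measurable_EFinP; exact: measurable_funX.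
apply: le_trans (separated_integral L _ sL eL mf'2 _); last first.
  by move=> x; rewrite lee_fin sqr_ge0.
rewrite -sumEFin; apply: lee_sum => a _; rewrite /Rintegral.
(* [fine] sends +oo to 0, so it never increases a nonnegative value. *)
have : (0 <= \int[@lebesgue_measure R]_(t in segment_interior a)
    (f' (edge_point a.1 t) ^+ 2)%:E)%E.
  by apply: integral_ge0 => t _; rewrite lee_fin sqr_ge0.
by case: (integral _ _ _) => //= r _; rewrite leey.
Qed.

Lemma sqr_increment_le (f f' : graph_point G -> R) (p q : graph_point G) (D : R) :
  H1_graph f f' -> 0 < D -> (graph_dist p q <= D%:E)%E ->
  (f p - f q) ^+ 2 <= D * \int[mu]_x (f' x ^+ 2).
Proof.
move=> Hf D0 pqD; rewrite -(real_normK (num_real (f p - f q))).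
set E := Rintegral _ _ _; have E0 : 0 <= E.
  by apply: Rintegral_ge0 => x _; exact: sqr_ge0.
apply: quadratic_from_AMGM => // c c0; apply/ler_addgt0Pr => e e0.
(* A path at most e / c longer than [D] exists by definition of the infimum; multiplied by [c], this
   excess costs exactly [e]. *)
have : (graph_dist p q < (D + e / c)%:E)%E.
  by apply: le_lt_trans pqD _; rewrite lte_fin ltrDl divr_gt0.
move=> /ereal_inf_lt[_ [l /= pl <-]]; rewrite lte_fin => lD.
have [L cL lL] := graph_path_chain _ _ _ _ pl.
have [L' [cL' lL' sL']] := chain_separated _ _ _ _ cL.
apply: (le_trans (chain_increment _ _ _ _ _ _ Hf cL' c0)).
have sE := separated_energy _ _ _ Hf sL' (chain_in_edge _ _ _ cL').
rewrite addrAC; apply: lerD.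
  have -> : c * D + e = c * (D + e / c) by field; rewrite gt_eqF.
  by rewrite ler_pM2l//; apply: le_trans lL' _; rewrite lL ltW.
by rewrite ler_pM2l ?invr_gt0.
Qed.

Lemma graph_measureT : mu setT = graph_volume G.
Proof.
apply: eq_esum => e _; rewrite preimage_setT setIT.
by rewrite lebesgue_measure_itv/= lte_fin mg_length_gt0 sube0.
Qed.

(** Finite volume makes the constant 1 square integrable, hence admissible as a test function in the
    eigenvalue equation. *)
Lemma H1_graph_cst1 : (graph_volume G < +oo)%E ->
  @H1_graph R G (fun=> 1) (fun=> 0).
Proof.
move=> Vfin.
have int1 (e : mg_edge G) k :
    (\int[@lebesgue_measure R]_(t in `]0%R, mg_length e[) k%:E = (k * mg_length e)%:E)%E.
  rewrite integral_cst//= lebesgue_measure_itv/= lte_fin mg_length_gt0.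
  by rewrite sube0.
split.
- by move=> p e e0; exists 1 => // q _; rewrite subrr normr0.
- move=> e; split.
  + split; first exact: measurable_cst.
    by under eq_integral do rewrite /= expr1n; rewrite int1 ltry.
  + split; first exact: measurable_cst.
    by under eq_integral do rewrite /= expr0n/=; rewrite int1 ltry.
  move=> phi [dphi cphi [a [b [a0 bl phi0]]]].
  rewrite [RHS](_ : _ = 0); last first.
    rewrite (_ : Rintegral _ _ _ = 0) ?oppr0//.
    rewrite -[RHS](mul0r (fine (lebesgue_measure
      (`]0, mg_length e[%classic : set R)))) -Rintegral_cst//.
    by apply: eq_Rintegral => x _; rewrite /= mul0r.
  under eq_Rintegral do rewrite mul1r.
  have dphi' (x : R) : is_derive x 1 phi (derive1 phi x).
    by apply: DeriveDef => //; rewrite derive1E.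
  (* A test function vanishes at both ends of the edge, so its derivative integrates to 0. *)
  have phi_eq0 (x : R) : x <= 0 \/ mg_length e <= x -> phi x = 0.
    by move=> h; apply/eqP; apply: contraT => /phi0; case: h => ?; lra.
  rewrite (Rintegral_derive (mg_length e) phi _ (mg_length_gt0 e) dphi' cphi).
  by rewrite !phi_eq0 ?subrr//; [left|right].
- under eq_esum.
    move=> e _; under eq_integral do rewrite expr1n expr0n/= addr0.
    rewrite int1 mul1r; over.
  exact: Vfin.
Qed.

Lemma poincare (f f' : graph_point G -> R) (D : R) :
  (0 < graph_volume G < +oo)%E -> 0 < D ->
  (forall p q : graph_point G, (graph_dist p q <= D%:E)%E) ->
  H1_graph f f' -> \int[mu]_x f x = 0 ->
  2 * \int[mu]_x (f x ^+ 2) <=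
    fine (graph_volume G) * D * \int[mu]_x (f' x ^+ 2).
Proof.
move=> /andP[V0 Vfin] D0 diam Hf f0.
have [mf mf'] := H1_graph_measurable _ _ Hf.
have [if2 if'2] := H1_graph_integrable _ _ Hf.
have mufin : (mu setT < +oo)%E by rewrite graph_measureT.
have icst k : mu.-integrable setT (EFin \o (fun=> k)) by exact: integrable_finite_cst.
have intf : mu.-integrable setT (EFin \o f).
  have := integrable_sqr_mul_bounded mu setT f (fun=> 1) measurableT mufin mf
    (measurable_cst _) (fun=> _) if2.
  by under eq_fun do rewrite mulr1; apply => _; rewrite normr1.
have intZ k g : mu.-integrable setT (EFin \o g) ->
    mu.-integrable setT (EFin \o (fun x => k * g x)).
  by move=> ig; exact: (integrableZl _ k ig).
have intD g h : mu.-integrable setT (EFin \o g) -> mu.-integrable setT (EFin \o h) ->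
    mu.-integrable setT (EFin \o (fun x => g x + h x)).
  by move=> ig ih; exact: (integrableD _ ig ih).
have Icst k : \int[mu]_x k = k * fine (graph_volume G).
  by rewrite Rintegral_cst// graph_measureT.
set V := fine _ in Icst *.
have V0' : 0 < V by rewrite fine_gt0// V0.
set A := \int[mu]_x (f x ^+ 2); set E := \int[mu]_x (f' x ^+ 2).
(* With [y] fixed, integrating the square of f x - f y in [x] kills the cross term, since [f] has
   mean zero. *)
have step y : A + f y ^+ 2 * V <= V * D * E.
  have -> : A + f y ^+ 2 * V = \int[mu]_x (f x ^+ 2 + ((- 2 * f y) * f x + f y ^+ 2)).
    rewrite RintegralD//; last exact: intD (intZ _ _ intf) (icst _).
    rewrite RintegralD//; last exact: intZ.
    by rewrite RintegralZl// f0 mulr0 add0r Icst.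
  have -> : V * D * E = \int[mu]_x (D * E) by rewrite Icst; ring.
  apply: le_Rintegral => //.
    exact: (intD _ _ if2 (intD _ _ (intZ _ _ intf) (icst _))).
  move=> x _; apply: le_trans (sqr_increment_le _ _ x y _ Hf D0 (diam x y)).
  by rewrite le_eqVlt; apply/orP; left; apply/eqP; ring.
(* Integration in [y] yields 2 A V on the left and V^2 D E on the right; one factor [V] cancels. Two
   successive single integrals replace a double integral. *)
have : \int[mu]_y (A + V * f y ^+ 2) <= \int[mu]_y (V * D * E).
  apply: le_Rintegral => //; first exact: (intD _ _ (icst _) (intZ _ _ if2)).
  by move=> y _; rewrite [V * f y ^+ 2]mulrC.
rewrite RintegralD//; last exact: intZ.
rewrite RintegralZl// !Icst -/A => h.
by rewrite -(ler_pM2r V0'); lra.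
Qed.

End energy.

(** * Eigenfunctions *)

Section eigenfunctions.
Context {R : realType} {G : metric_graph R}.
Local Notation mu := (@graph_measure R G : {measure set (graph_point G) -> \bar R}).

Lemma eigenfunction_energy (f : graph_point G -> R) (lam : R) :
  (graph_volume G < +oo)%E ->
  neumann_laplacian f (fun x => lam * f x) ->
  exists f', [/\ H1_graph f f',
    \int[mu]_x (f' x ^+ 2) = lam * \int[mu]_x (f x ^+ 2) &
    lam != 0 -> \int[mu]_x f x = 0].
Proof.
move=> Vfin [_ [f' Hf eqf]]; exists f'.
have [if2 if'2] := H1_graph_integrable _ _ Hf.
have [mf _] := H1_graph_measurable _ _ Hf.
have intf : mu.-integrable setT (EFin \o (fun x => f x * 1)).
  apply: integrable_sqr_mul_bounded => //; first by rewrite graph_measureT.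
  by move=> _; rewrite normr1.
split => //.
  rewrite -RintegralZl//; under eq_Rintegral do rewrite expr2.
  (* The eigenfunction itself serves as the test function. *)
  by rewrite (eqf _ _ Hf); apply: eq_Rintegral => x _; rewrite expr2 mulrA.
move=> lam0; have := eqf _ _ (H1_graph_cst1 Vfin).
under eq_Rintegral do rewrite mulr0.
rewrite Rintegral_cst// mul0r; under eq_Rintegral do rewrite -mulrA.
rewrite RintegralZl// => /esym/eqP; rewrite mulf_eq0 (negbTE lam0)/= => /eqP <-.
by apply: eq_Rintegral => x _; rewrite mulr1.
Qed.

Lemma L2_independent_norm_gt0 (n : nat) (f : 'I_n -> graph_point G -> R) i :
  mu.-integrable setT (EFin \o (fun x => f i x ^+ 2)) ->
  L2_independent f -> 0 < \int[mu]_x (f i x ^+ 2).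
Proof.
move=> if2 indep; rewrite lt_neqAle Rintegral_ge0 ?andbT; last first.
  by move=> x _; exact: sqr_ge0.
apply/eqP => A0.
have /(ae_eq_integral_abs mu measurableT (measurable_int _ if2)) f0 :
    (\int[mu]_x `|(f i x ^+ 2)%:E| = 0)%E.
  have := fineK (integrable_fin_num measurableT if2).
  rewrite -[fine _]/(\int[mu]_x (f i x ^+ 2)) -A0 => /esym I0; rewrite -[RHS]I0.
  by apply: eq_integral => x _; rewrite gee0_abs// lee_fin sqr_ge0.
have : (1 : R) = 0; last by move/eqP; rewrite oner_eq0.
(* If [f i] vanished almost everywhere, the i-th unit vector would be a nontrivial relation. *)
have := indep (fun j => (j == i)%:R) _ i; rewrite eqxx; apply.
apply: filterS f0 => x /(_ Logic.I) /= [] /eqP; rewrite sqrf_eq0 => /eqP fx.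
rewrite (bigD1 i)//= eqxx mul1r fx add0r big1// => j /negbTE ->.
by rewrite mul0r.
Qed.

Lemma eigenvalue_ge (f : graph_point G -> R) (lam : R) :
  (0 < graph_volume G < +oo)%E -> (0 < graph_diameter G)%E ->
  neumann_laplacian f (fun x => lam * f x) ->
  0 < \int[mu]_x (f x ^+ 2) -> lam != 0 ->
  2 / (fine (graph_volume G) * fine (graph_diameter G)) <= lam.
Proof.
move=> V0 D0 eqf A0 lam0; have /andP[V0' Vfin] := V0.
have [f' [Hf E f0]] := eigenfunction_energy _ _ Vfin eqf.
have lam_ge0 : 0 <= lam.
  rewrite -(pmulr_lge0 _ A0) -E; apply: Rintegral_ge0 => x _; exact: sqr_ge0.
case DE : (graph_diameter G) => [D||]; last by rewrite DE in D0.
  have {}D0 : 0 < D by rewrite DE lte_fin in D0.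
  have V : 0 < fine (graph_volume G) by rewrite fine_gt0.
  have diam (p q : graph_point G) : (graph_dist p q <= D%:E)%E.
    by rewrite -DE; apply: ereal_sup_ubound; exists (p, q).
  have := poincare _ _ _ V0 D0 diam Hf (f0 lam0).
  rewrite E mulrA ler_pM2r// => h.
  by rewrite ler_pdivrMr/= ?mulr_gt0// mulrC.
(* For an infinite diameter [fine] returns 0 and the inverse of 0 is 0, so the claim reduces to
   [lam_ge0]. *)
by rewrite /= mulr0 invr0 mulr0.
Qed.

Lemma harmonic_constant (f : graph_point G -> R) (lam : R) :
  graph_connected G -> (graph_volume G < +oo)%E ->
  neumann_laplacian f (fun x => lam * f x) -> lam = 0 ->
  forall x y, f x = f y.
Proof.
move=> conn Vfin eqf lam0 x y.
have [f' [Hf E _]] := eigenfunction_energy _ _ Vfin eqf.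
have [l xy] := conn x y.
(* The added 1 makes the distance bound positive, as required by [sqr_increment_le], even when l =
   0. *)
have dxy : (graph_dist x y <= (`|l| + 1)%:E)%E.
  apply: (@le_trans _ _ l%:E); first by apply: ereal_inf_lbound; exists l.
  by rewrite lee_fin (le_trans (ler_norm l))// lerDl.
have := sqr_increment_le _ _ _ _ _ Hf (ltr_wpDl (normr_ge0 l) ltr01) dxy.
rewrite E lam0 mul0r mulr0 => h; apply/eqP.
by rewrite -subr_eq0 -sqrf_eq0 eq_le h sqr_ge0.
Qed.

End eigenfunctions.

Theorem proposition4p12 (R : realType) (G : metric_graph R)
  (G_lf : locally_finite_graph G)
  (G_conn : graph_connected G)
  (G_vol_fin : (graph_volume G < +oo)%E)
  (G_vol_gt0 : (0 < graph_volume G)%E)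
  (G_diam_gt0 : (0 < graph_diameter G)%E)
  (G_betti : (betti_number G < +oo)%E)
  (mu2 : R) (mu2P : neumann_eigenvalue G 2 mu2) :
  2 / (fine (graph_volume G) * fine (graph_diameter G)) <= mu2.
Proof.
have [[lam [f [lam_le eqf indep]]] _] := mu2P.
have V : (0 < graph_volume G < +oo)%E by rewrite G_vol_gt0.
have norm_gt0 i : 0 < \int[@graph_measure R G]_x (f i x ^+ 2).
  have [f' [Hf _ _]] := eigenfunction_energy _ _ G_vol_fin (eqf i).
  have [if2 _] := H1_graph_integrable _ _ Hf.
  exact: L2_independent_norm_gt0.
have [[i lam0]|/forallNP lam0] := pselect (exists i, lam i != 0).
  apply: le_trans (lam_le i); exact: (eigenvalue_ge (f i)).
pose o := Vertex (mg_base G).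
have fE i x : f i x = f i o.
  apply: (harmonic_constant (f i) (lam i)) => //.
  by apply/eqP; apply: contra_notT (lam0 i).
(* A vector orthogonal to the pair of constant values, hence a linear relation. Independence forces
   the value of [f ord_max] to be 0, against its positive norm. *)
pose a (i : 'I_2) : R := if i == ord0 then f ord_max o else - f ord0 o.
have /(_ ord0) : forall i, a i = 0.
  apply: indep; apply: aeW => x.
  rewrite big_ord_recl big_ord1 !fE /a/=.
  rewrite (_ : lift ord0 ord0 = ord_max); last exact/val_inj.
  by rewrite mulNr mulrC subrr.
rewrite /a/= => f1; have := norm_gt0 ord_max.
rewrite (_ : Rintegral _ _ _ = 0) ?ltxx//.
rewrite -[RHS](mul0r (fine (@graph_measure R G setT))) -Rintegral_cst//.
by apply: eq_Rintegral => x _; rewrite fE f1 expr0n.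
Qed.
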